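(* Let $k\ge1$ and let $\zeta_1,\dots,\zeta_k>0$, $\alpha_1,\dots,\alpha_k>0$ be real. Let $x_1,\dots,x_k$ be mutually independent, $x_j$ having the type-1 beta density $$f_j(x_j)=\frac{\Gamma(\zeta_j+\alpha_j)}{\Gamma(\zeta_j)\Gamma(\alpha_j)}x_j^{\zeta_j-1}(1-x_j)^{\alpha_j-1},\quad 0<x_j<1,$$ and $0$ elsewhere. Let $(v_1,\dots,v_k)$ be a vector of positive real random variables with an arbitrary joint density $f(v_1,\dots,v_k)$ on $(0,\infty)^k$, independent of $(x_1,\dots,x_k)$. Put $u_j=v_j/x_j$, $j=1,\dots,k$, and let $g(u_1,\dots,u_k)$ be the joint density of $(u_1,\dots,u_k)$. Then, for (almost every) $(u_1,\dots,u_k)\in(0,\infty)^k$, $$\Big\{\prod_{j=1}^k\frac{\Gamma(\zeta_j)}{\Gamma(\zeta_j+\alpha_j)}\Big\}g(u_1,\dots,u_k)=I_{u_j,j=1,\dots,k}^{(\zeta_j,\alpha_j),j=1,\dots,k}f(u_1,\dots,u_k).$$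
   Context: The multivariable Kober fractional integral operator of the first kind is defined by $$I_{u_j,j=1,\dots,k}^{(\zeta_j,\alpha_j),j=1,\dots,k}f(u_1,\dots,u_k)=\Big\{\prod_{j=1}^k\frac{u_j^{-\zeta_j-\alpha_j}}{\Gamma(\alpha_j)}\Big\}\int_{0}^{u_1}\cdots\int_{0}^{u_k}\Big\{\prod_{j=1}^k(u_j-v_j)^{\alpha_j-1}v_j^{\zeta_j}\Big\}f(v_1,\dots,v_k)\,dv_1\cdots dv_k.$$ *)

(* Defs.v *)
From HB Require Import structures.
From mathcomp Require Import all_boot all_order all_algebra.
From mathcomp Require Import all_classical all_reals all_analysis.
Set Implicit Arguments. Unset Strict Implicit. Unset Printing Implicit Defensive.
Import Order.TTheory GRing.Theory Num.Theory.
Import numFieldNormedType.Exports.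
Local Open Scope classical_set_scope.
Local Open Scope ring_scope.

Section Kober.
Variable R : realType.
Local Notation mu := (@lebesgue_measure R).

Definition Gamma (s : R) : R :=
  fine (\int[mu]_(t in [set t : R | (0 < t)%R]) (t `^ (s - 1) * expR (- t))%:E)%E.

(* Lebesgue integral on R^k (k-tuples of reals) of a nonnegative function,
   written as the iterated Lebesgue integral (equal to the integral against
   k-dimensional Lebesgue measure by Tonelli for nonnegative measurable F). *)
Fixpoint iint (k : nat) : (k.-tuple R -> \bar R) -> \bar R :=
  match k with
  | 0 => fun F => F [tuple]
  | k'.+1 => fun F => (\int[mu]_x iint (fun t => F (cons_tuple x t)))%E
  end.

Definition ae_k (k : nat) (Q : k.-tuple R -> Prop) : Prop :=
  exists N : set (k.-tuple R), measurable N /\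
    iint (fun t => (\1_N t)%:E) = 0%E /\ ~` [set t | Q t] `<=` N.

Definition is_density_k d (T : measurableType d) (P : probability T R)
    (k : nat) (X : T -> k.-tuple R) (g : k.-tuple R -> R) : Prop :=
  (forall t, 0 <= g t) /\ measurable_fun setT g /\
  forall B : set (k.-tuple R), measurable B ->
    P (X @^-1` B) = iint (fun t => (\1_B t * g t)%:E).

Definition beta1_pdf (z a : R) (t : R) : R :=
  \1_(`]0, 1[ : set R) t *
  (Gamma (z + a) / (Gamma z * Gamma a) * t `^ (z - 1) * (1 - t) `^ (a - 1)).

Definition indep_coords_vec d (T : measurableType d) (P : probability T R)
    (k : nat) (x : T -> k.-tuple R) (v : T -> k.-tuple R) : Prop :=
  forall (A : 'I_k -> set R) (B : set (k.-tuple R)),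
    (forall j, measurable (A j)) -> measurable B ->
    P ([set w | forall j, A j (tnth (x w) j)] `&` v @^-1` B) =
    ((\prod_(j < k) P ((fun w => tnth (x w) j) @^-1` A j)) * P (v @^-1` B))%E.

Definition kober (k : nat) (z a : 'I_k -> R) (f : k.-tuple R -> R)
    (u : k.-tuple R) : \bar R :=
  ((\prod_(j < k) (tnth u j `^ (- z j - a j) / Gamma (a j)))%:E *
   iint (fun t =>
     (\1_([set s : k.-tuple R | forall j, 0 < tnth s j < tnth u j]) t *
      (\prod_(j < k) ((tnth u j - tnth t j) `^ (a j - 1) * tnth t j `^ z j)) *
      f t)%:E))%E.

End Kober.

(* Main.v *)
Require Import Defs.
From HB Require Import structures.
From mathcomp Require Import all_boot all_order all_algebra.
From mathcomp Require Import all_classical all_reals all_analysis.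
From mathcomp Require Import measurable_realfun.
From mathcomp Require Import ring.
Import Order.TTheory GRing.Theory Num.Theory.
Import numFieldNormedType.Exports.
Local Open Scope classical_set_scope.
Local Open Scope ring_scope.

(* By independence, P(v/x in B) is the integral of prod_j b_j(x_j) f(v) over
   the pairs (x, v) with v/x in B, where b_j is the density of x_j.  For fixed
   x the substitution v = u x is a linear scaling, so Tonelli identifies g,
   almost everywhere, with
     g(u) = int prod_j (b_j(x_j) x_j) f(x u) dx.
   For fixed u > 0 the substitution x = v/u is again a linear scaling, and it
   turns the right-hand side into the Kober integral.  Passing through v = u x
   rather than through x = v/u from the start avoids the nonlinear change of
   variables u -> v/u. *)

(** * Measures with a density, and uniqueness of measures on boxes *)

Lemma density_measure d (T : measurableType d) (R : realType)
    (m : {measure set T -> \bar R}) (p : T -> \bar R) :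
  measurable_fun setT p -> (forall x, 0 <= p x)%E ->
  exists m' : {measure set T -> \bar R},
    forall A, measurable A -> m' A = (\int[m]_(x in A) p x)%E.
Proof.
move=> mp p0; pose q A := (\int[m]_(x in A) p x)%E.
have q0 : q set0 = 0%E by rewrite /q integral_set0.
have qge0 A : (0 <= q A)%E by exact: integral_ge0.
have qadd : semi_sigma_additive q.
  move=> /= F mF tF mUF; rewrite /q ge0_integral_bigcup//=; last first.
    exact: measurable_funTS.
  apply: cvg_toP => //; apply: ereal_nondecreasing_is_cvgn => i j ij.
  by apply: lee_sum_nneg_natr => // k _ _; exact: integral_ge0.
pose M := isMeasure.Build d T R q q0 qge0 qadd.
by exists (HB.pack q M : {measure set T -> \bar R}).
Qed.

Lemma measurable_box d (T : measurableType d) (k : nat) (A : 'I_k -> set T) :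
  (forall j, measurable (A j)) ->
  measurable [set t : k.-tuple T | forall j, A j (tnth t j)].
Proof.
move=> mA; rewrite [X in measurable X](_ : _ =
  \bigcap_(j in [set: 'I_k]) ((fun t => tnth t j) @^-1` A j)).
  apply: fin_bigcap_measurable => // j _.
  by rewrite -[X in measurable X]setTI; exact: measurable_tnth.
by apply/seteqP; split => t /= h j; [move=> _|]; exact: h.
Qed.

(** Boxes form a pi-system that contains the whole space and generates the product sigma-algebra, so
    a finite measure is determined by its values on them. Boxes are exactly the sets on which
    [indep_coords_vec] gives information. *)
Lemma eq_measure_box d1 d2 (T1 : measurableType d1) (T2 : measurableType d2)
    (R : realType) (k : nat)
    (m1 m2 : {measure set (k.-tuple T1 * T2) -> \bar R}) :
  (m1 setT < +oo)%E ->
  (forall (A : 'I_k -> set T1) B, (forall j, measurable (A j)) ->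
    measurable B -> m1 ([set t | forall j, A j (tnth t j)] `*` B) =
    m2 ([set t | forall j, A j (tnth t j)] `*` B)) ->
  forall C, measurable C -> m1 C = m2 C.
Proof.
move=> m1oo m12.
pose G : set (set (k.-tuple T1 * T2)) :=
  [set C | exists (A : 'I_k -> set T1) B, [/\ (forall j, measurable (A j)),
    measurable B & C = [set t | forall j, A j (tnth t j)] `*` B]].
have GT : G setT.
  exists (fun=> setT), setT; split => //.
  by apply/seteqP; split.
apply: (measure_unique G (fun=> setT)) => //.
- apply/seteqP; split; last first.
    apply: smallest_sub; first exact: sigma_algebra_measurable.
    move=> _ [A [B [mA mB ->]]].
    by apply: measurableX => //; exact: measurable_box.
  move=> C mC.
  have mfst : measurable_fun setT (fst : g_sigma_algebraType G -> k.-tuple T1).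
    apply/measurable_fun_tnthP => i _ Y mY; rewrite setTI.
    apply: sub_sigma_algebra.
    exists (fun j => if j == i then Y else setT), setT; split => //.
      by move=> j; case: ifP.
    apply/seteqP; split => [[t s]/= Yt|[t s]/= [/(_ i)]]; last by rewrite eqxx.
    by split => // j; case: eqP => [->|].
  have msnd : measurable_fun setT (snd : g_sigma_algebraType G -> T2).
    move=> _ Y mY; rewrite setTI; apply: sub_sigma_algebra.
    exists (fun=> setT), Y; split => //.
    by apply/seteqP; split => [[t s]/= Yt|[t s]/= []].
  (* The pairing of the two projections is the identity; its measurability with respect to the
     sigma-algebra generated by [G] puts [C] in that sigma-algebra. *)
  have /(_ measurableT _ mC) := measurable_fun_pair mfst msnd.
  by rewrite setTI (_ : _ @^-1` C = C)//; apply/seteqP; split => -[].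
- move=> _ _ [A [B [mA mB ->]]] [A' [B' [mA' mB' ->]]].
  exists (fun j => A j `&` A' j), (B `&` B'); split.
  + by move=> j; exact: measurableI.
  + exact: measurableI.
  + apply/seteqP; split => -[t s]/=.
      by move=> [[h1 h2] [h3 h4]].
    by move=> [h [h2 h3]]; split; split => // j; have [] := h j.
- by rewrite bigcup_const.
- by move=> _ [A [B [mA mB ->]]]; exact: m12.
Qed.


(** * The iterated integral as integration against a sigma-finite measure *)

Lemma product_sigma_finite d1 d2 (T1 : measurableType d1)
    (T2 : measurableType d2) (R : realType)
    (m1 : {sigma_finite_measure set T1 -> \bar R})
    (m2 : {sigma_finite_measure set T2 -> \bar R}) :
  sigma_finite setT (m1 \x m2)%E.
Proof.
have /sigma_finiteP[/= F [TF ndF Foo]] := sigma_finiteT m1.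
have /sigma_finiteP[/= G [TG ndG Goo]] := sigma_finiteT m2.
exists (fun n => F n `*` G n).
  apply/seteqP; split => // -[x y] _ /=.
  have [i _ Fx] : (\bigcup_i F i) x by rewrite -TF.
  have [j _ Gy] : (\bigcup_i G i) y by rewrite -TG.
  (* Both exhausting sequences increase, so a single index serves both coordinates. *)
  exists (maxn i j) => //; split.
    by move: x Fx; exact/subsetPset/ndF/leq_maxl.
  by move: y Gy; exact/subsetPset/ndG/leq_maxr.
move=> n; have [mF F_oo] := Foo n; have [mG G_oo] := Goo n.
split; first exact: measurableX.
by rewrite product_measure1E// lte_mul_pinfty// ge0_fin_numE.
Qed.

(** This makes Tonelli and almost-everywhere uniqueness available for [iint]. Starting from a Dirac
    mass on the empty tuple, each dimension takes the image under [cons_tuple] of the product of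
    Lebesgue measure with the previous measure. *)
Lemma iint_measure (R : realType) (k : nat) :
  exists m : {sigma_finite_measure set (k.-tuple R) -> \bar R},
    forall F : k.-tuple R -> \bar R, measurable_fun setT F ->
      (forall t, 0 <= F t)%E -> iint F = (\int[m]_t F t)%E.
Proof.
elim: k => [|k [m mE]].
  exists (\d_ ([tuple] : 0.-tuple R)) => F mF F0 /=.
  by rewrite integral_dirac// diracT mul1e.
pose phi (p : measurableTypeR R * k.-tuple R) : k.+1.-tuple R :=
  cons_tuple p.1 p.2.
have mphi : measurable_fun setT phi.
  exact: (measurable_cons measurable_fst measurable_snd).
pose m1 : {measure set (measurableTypeR R * k.-tuple R)%type -> \bar R} :=
  (@lebesgue_measure R \x m)%E.
have sf : sigma_finite setT (pushforward m1 phi).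
  have [E TE mE'] := product_sigma_finite _ _ _ _ _ (@lebesgue_measure R) m.
  pose psi (t : k.+1.-tuple R) : measurableTypeR R * k.-tuple R :=
    (thead t, behead_tuple t).
  have phiK : cancel phi psi.
    by move=> [x t]; rewrite /psi /phi/= theadE; congr pair; exact: val_inj.
  have mpsi : measurable_fun setT psi.
    by apply: measurable_fun_pair;
      [exact: measurable_tnth|exact: measurable_behead].
  exists (fun n => psi @^-1` E n).
    by rewrite -preimage_bigcup -TE preimage_setT.
  move=> n; have [mEn Eoo] := mE' n; split.
    by rewrite -[X in measurable X]setTI; exact: mpsi.
  rewrite /pushforward -comp_preimage (_ : psi \o phi = id)//.
  exact/funext/phiK.
pose M := Measure_isSigmaFinite.Build _ _ R (pushforward m1 phi) sf.
pose m2 : {sigma_finite_measure set (k.+1.-tuple R) -> \bar R} :=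
  HB.pack (pushforward m1 phi) (M mphi).
exists (m2 mphi) => F mF F0.
rewrite [RHS](ge0_integral_pushforward mphi)//= preimage_setT.
have mFphi : measurable_fun setT (F \o phi) by exact: measurableT_comp.
rewrite fubini_tonelli1//=.
apply: eq_integral => x _; rewrite mE//.
apply: (measurableT_comp mF).
exact: (@measurable_cons _ _ _ _ (cst x) _ id).
Qed.

(** * Scaling, linearity and product rules for the iterated integral *)

Lemma ge0_integral_scale (R : realType) (c : R) (F : R -> \bar R) :
  0 < c -> measurable_fun setT F -> (forall x, 0 <= F x)%E ->
  (\int[@lebesgue_measure R]_x F x =
   c%:E * \int[@lebesgue_measure R]_x F (c * x)%R)%E.
Proof.
move=> c0 mF F0; pose phi (x : measurableTypeR R) : measurableTypeR R := c * x.
have mphi : measurable_fun setT phi by exact: measurable_funM.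
have [pf pfE] : exists pf : {measure set (measurableTypeR R) -> \bar R},
    forall A, pf A = pushforward (@lebesgue_measure R) phi A.
  pose pf : {measure set (measurableTypeR R) -> \bar R} :=
    pushforward (@lebesgue_measure R) phi.
  by exists (pf mphi).
pose cn := NngNum (ltW c0).
(* The measure [c] times the image of Lebesgue measure under multiplication by [c] gives every
   half-open interval its length, hence is Lebesgue measure. *)
transitivity (\int[mscale cn pf]_x F x)%E.
  apply: eq_measure_integral => A mA _ /=.
  apply: (@lebesgue_measure_unique R (mscale cn pf)) => // _ [[a b]] _ <-.
  rewrite -[RHS]/(c%:E * pf _)%E pfE /pushforward.
  rewrite (_ : phi @^-1` _ = `]a / c, b / c]%classic); last first.
    apply/seteqP; split => x /=; rewrite !in_itv/= ltr_pdivrMr// ler_pdivlMr//;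
      by rewrite /phi mulrC.
  rewrite !lebesgue_measure_itv/= !lte_fin ltr_pM2r ?invr_gt0//.
  case: ifPn => _; last by rewrite mule0.
  by rewrite -!EFinD -EFinM -mulrBl mulrCA divff ?gt_eqF// mulr1.
rewrite ge0_integral_mscale//=; congr (_ * _)%E.
rewrite (eq_measure_integral (pushforward (@lebesgue_measure R) phi))//.
by rewrite (ge0_integral_pushforward mphi)//= preimage_setT.
Qed.

Lemma iint_ge0 (R : realType) (k : nat) (F : k.-tuple R -> \bar R) :
  (forall t, 0 <= F t)%E -> (0 <= iint F)%E.
Proof.
elim: k F => [|k IH] F F0 /=; first exact: F0.
by apply: integral_ge0 => x _; exact: IH.
Qed.

Lemma eq_iint (R : realType) (k : nat) (F G : k.-tuple R -> \bar R) :
  F =1 G -> iint F = iint G.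
Proof. by move=> /funext ->. Qed.

Lemma ge0_iintZl (R : realType) (k : nat) (c : R) (F : k.-tuple R -> \bar R) :
  0 <= c -> measurable_fun setT F -> (forall t, 0 <= F t)%E ->
  iint (fun t => c%:E * F t)%E = (c%:E * iint F)%E.
Proof.
move=> c0 mF F0; have [m mE] := iint_measure R k.
rewrite !mE//; first exact: ge0_integralZl_EFin.
- exact: measurable_funeM.
- by move=> t; rewrite mule_ge0.
Qed.

(** Measurability of the section integrals in Tonelli's theorem, for the measure of [iint_measure].
    It lets the outer integral of an [iint] be scaled or multiplied by a constant. *)
Lemma measurable_iint d (T : measurableType d) (R : realType) (k : nat)
    (F : T -> k.-tuple R -> \bar R) :
  measurable_fun setT (fun p : T * k.-tuple R => F p.1 p.2) ->
  (forall x t, 0 <= F x t)%E -> measurable_fun setT (fun x => iint (F x)).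
Proof.
move=> mF F0; have [m mE] := iint_measure R k.
rewrite (_ : (fun x => _) = fubini_F m (fun p : T * k.-tuple R => F p.1 p.2)).
  by apply: measurable_fun_fubini_tonelli_F => // -[x t]; exact: F0.
apply/funext => x; rewrite mE//.
exact: (measurableT_comp mF (pair1_measurable x)).
Qed.

Lemma measurable_cons_tuple (R : realType) (k : nat) :
  measurable_fun setT
    (fun p : R * k.-tuple R => cons_tuple p.1 p.2 : k.+1.-tuple R).
Proof. exact: (measurable_cons measurable_fst measurable_snd). Qed.

Definition mul_tuple (R : realType) (k : nat) (c : 'I_k -> R)
    (t : k.-tuple R) :=
  [tuple c j * tnth t j | j < k].

Lemma measurable_mul_tuple (R : realType) (k : nat) (c : 'I_k -> R) :
  measurable_fun setT (mul_tuple R k c).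
Proof.
apply/measurable_fun_tnthP => i.
rewrite (_ : _ \o _ = fun t => c i * tnth t i).
  by apply: measurable_funM => //; exact: measurable_tnth.
by apply/funext => t /=; rewrite tnth_mktuple.
Qed.

(** The one-dimensional rule handles the outermost variable and induction the others, each
    contributing its own factor to the Jacobian. This is the only change of variables in the whole
    proof. *)
Lemma ge0_iint_scale (R : realType) (k : nat) (c : 'I_k -> R)
    (F : k.-tuple R -> \bar R) :
  (forall j, 0 < c j) -> measurable_fun setT F -> (forall t, 0 <= F t)%E ->
  iint F = ((\prod_(j < k) c j)%:E * iint (fun t => F (mul_tuple R k c t)))%E.
Proof.
elim: k c F => [|k IH] c F c0 mF F0.
  by rewrite big_ord0 mul1e /=; congr (F _); apply: eq_from_tnth => -[].
have mFc : measurable_fun setT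
    (fun p : R * k.-tuple R => F (cons_tuple p.1 p.2)).
  exact: (measurableT_comp mF (measurable_cons_tuple R k)).
pose c' j := c (lift ord0 j).
have P0 : 0 <= \prod_(j < k) c' j by apply: prodr_ge0 => j _; exact/ltW/c0.
have E x t : cons_tuple (c ord0 * x) (mul_tuple R k c' t) =
    mul_tuple R k.+1 c (cons_tuple x t).
  apply: eq_from_tnth => i; rewrite tnth_mktuple.
  have [j ->|->] := unliftP ord0 i; last by rewrite !tnth0.
  by rewrite !tnthS tnth_mktuple.
rewrite /= (ge0_integral_scale R (c ord0))//; last 2 first.
  by apply: measurable_iint => // x t; exact: F0.
  by move=> x; exact: iint_ge0.
rewrite big_ord_recl EFinM -muleA; congr (_ * _)%E.
rewrite -[LHS]/(\int[@lebesgue_measure R]_x _)%E.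
under eq_integral.
  move=> x _; rewrite (IH c'); last 3 first.
  - by move=> j; exact: c0.
  - apply: (measurableT_comp mF).
    exact: (@measurable_cons _ _ _ _ (cst (c ord0 * x)) _ id).
  - by move=> t; exact: F0.
  under eq_iint do rewrite E.
  over.
rewrite ge0_integralZl_EFin//.
  by move=> x _; exact: iint_ge0.
apply: (measurable_iint _ (measurableTypeR R) R k
  (fun x t => F (mul_tuple R k.+1 c (cons_tuple x t)))) => //.
apply: (measurableT_comp mF).
apply: (measurableT_comp (measurable_mul_tuple R k.+1 c)).
exact: measurable_cons_tuple.
Qed.

(** Each factor depends on one coordinate and is constant for the integrals inside it, so the
    factors come out one at a time. *)
Lemma ge0_iint_prod (R : realType) (k : nat) (b : 'I_k -> R -> R) :
  (forall j, measurable_fun setT (b j)) -> (forall j x, 0 <= b j x) ->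
  iint (fun t => (\prod_(j < k) b j (tnth t j))%:E) =
  (\prod_(j < k) \int[@lebesgue_measure R]_x (b j x)%:E)%E.
Proof.
elim: k b => [|k IH] b mb b0; first by rewrite /= !big_ord0.
rewrite big_ord_recl -(IH (fun j => b (lift ord0 j)))//.
have mprod : measurable_fun setT (fun t : k.-tuple R =>
    (\prod_(j < k) b (lift ord0 j) (tnth t j))%:E).
  apply/measurable_EFinP; apply: measurable_prod => j _.
  exact: (measurableT_comp (mb _) (measurable_tnth j)).
have p0 (t : k.-tuple R) :
    (0 <= (\prod_(j < k) b (lift ord0 j) (tnth t j))%:E)%E.
  by rewrite lee_fin; apply: prodr_ge0.
rewrite /=; under eq_integral.
  move=> x _; under eq_iint.
    move=> t; rewrite big_ord_recl tnth0 EFinM.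
    under eq_bigr do rewrite tnthS.
    over.
  rewrite ge0_iintZl//; over.
rewrite ge0_integralZr//.
- by apply/measurable_EFinP; exact: mb.
- by move=> x _; rewrite lee_fin.
- exact: iint_ge0.
Qed.

(* Squaring first keeps the real power away from negative bases, where it is
   junk. *)
Lemma measurable_inv (R : realType) : measurable_fun setT (@GRing.inv R).
Proof.
rewrite (_ : @GRing.inv R = fun x => x * (x ^+ 2) `^ (-1)).
  apply: measurable_funM => //.
  by apply: (measurableT_comp (measurable_powR (-1))); exact: measurable_funX.
apply/funext => x; rewrite powR_inv1 ?sqr_ge0//.
have [->|x0] := eqVneq x 0; first by rewrite mul0r invr0.
by rewrite expr2 invfM mulrA divff// mul1r.
Qed.

(** * The joint law of numerators and denominators, and the density of the quotient *)

Lemma ge0_iint_indic (R : realType) (k : nat)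
    (m : {sigma_finite_measure set (k.-tuple R) -> \bar R})
    (F : k.-tuple R -> R) (B : set (k.-tuple R)) :
  (forall F : k.-tuple R -> \bar R, measurable_fun setT F ->
      (forall t, 0 <= F t)%E -> iint F = (\int[m]_t F t)%E) ->
  measurable_fun setT F -> (forall t, 0 <= F t) -> measurable B ->
  iint (fun t => (\1_B t * F t)%:E) = (\int[m]_(t in B) (F t)%:E)%E.
Proof.
move=> mE mF F0 mB; rewrite mE.
- rewrite [RHS]integral_mkcond; apply: eq_integral => t _.
  by rewrite patchE indicE; case: ifP; rewrite ?mul1r ?mul0r.
- apply/measurable_EFinP; apply: measurable_funM; last exact: mF.
  exact: measurable_indic.
- by move=> t; rewrite lee_fin mulr_ge0.
Qed.

(** On boxes, independence and Tonelli give both sides the same product value; [eq_measure_box]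
    extends this to all measurable sets. The event that the quotient lies in a given set is not a
    box, which is why the extension is needed. *)
Lemma joint_law d (T : measurableType d) (R : realType) (P : probability T R)
    (k : nat) (m : {sigma_finite_measure set (k.-tuple R) -> \bar R})
    (b : 'I_k -> R -> R) (x v : T -> k.-tuple R) (f : k.-tuple R -> R) :
  (forall F : k.-tuple R -> \bar R, measurable_fun setT F ->
      (forall t, 0 <= F t)%E -> iint F = (\int[m]_t F t)%E) ->
  (forall j, measurable_fun setT (b j)) -> (forall j y, 0 <= b j y) ->
  measurable_fun setT x -> measurable_fun setT v ->
  (forall j A, measurable A -> P ((fun w => tnth (x w) j) @^-1` A) =
     (\int[@lebesgue_measure R]_(t in A) (b j t)%:E)%E) ->
  is_density_k P v f -> indep_coords_vec P x v ->
  forall C, measurable C ->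
    P ((fun w => (x w, v w)) @^-1` C) =
    (\int[(m \x m)%E]_(p in C) (\prod_(j < k) b j (tnth p.1 j) * f p.2)%:E)%E.
Proof.
move=> mE mb b0 mx mv hb [f0 [mf hf]] ind.
pose p (q : k.-tuple R * k.-tuple R) :=
  (\prod_(j < k) b j (tnth q.1 j) * f q.2)%:E.
have mprod (c : 'I_k -> R -> R) : (forall j, measurable_fun setT (c j)) ->
    measurable_fun setT (fun t : k.-tuple R => \prod_(j < k) c j (tnth t j)).
  move=> mc; apply: measurable_prod => j _.
  exact: (measurableT_comp (mc j) (measurable_tnth j)).
have mp : measurable_fun setT p.
  apply/measurable_EFinP; apply: measurable_funM.
    exact: (measurableT_comp (mprod b mb)).
  exact: measurableT_comp.
have p0 q : (0 <= p q)%E by rewrite lee_fin mulr_ge0// prodr_ge0.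
have [m2 m2E] := density_measure _ _ R (m \x m)%E p mp p0.
have [m1 m1E] : exists m1 :
      {measure set (k.-tuple R * k.-tuple R)%type -> \bar R},
    forall C, m1 C = P ((fun w => (x w, v w)) @^-1` C).
  have mxv : measurable_fun setT (fun w => (x w, v w)).
    exact: measurable_fun_pair.
  pose m1 : {measure set (k.-tuple R * k.-tuple R)%type -> \bar R} :=
    pushforward P (fun w => (x w, v w)).
  by exists (m1 mxv).
move=> C mC; rewrite -m1E -m2E//.
apply: eq_measure_box => // [|A B mA mB].
  by rewrite m1E preimage_setT probability_setT ltry.
rewrite m1E m2E; last by apply: measurableX => //; exact: measurable_box.
rewrite [LHS](_ : _ = P ([set w | forall j, A j (tnth (x w) j)] `&` v @^-1` B));
  last by congr (P _); apply/seteqP; split.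
rewrite ind// hf//.
(* Absorbing the indicators of the box into the factors turns the integral over the box into one
   over the whole space, still of product form. *)
pose c j y := \1_(A j) y * b j y.
have mc j : measurable_fun setT (c j).
  by apply: measurable_funM => //; exact: measurable_indic.
have c0 j y : 0 <= c j y by rewrite mulr_ge0.
pose fB t := \1_B t * f t.
have mfB : measurable_fun setT fB.
  by apply: measurable_funM => //; exact: measurable_indic.
have fB0 t : 0 <= fB t by rewrite mulr_ge0.
have -> : (\prod_(j < k) P ((fun w => tnth (x w) j) @^-1` A j) =
    \int[m]_t (\prod_(j < k) c j (tnth t j))%:E)%E.
  rewrite -mE; last 2 first.
    by apply/measurable_EFinP; exact: mprod.
    by move=> t; rewrite lee_fin prodr_ge0.
  rewrite ge0_iint_prod//; apply: eq_bigr => j _; rewrite hb// integral_mkcond.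
  apply: eq_integral => y _.
  by rewrite patchE /c indicE; case: ifP; rewrite ?mul1r ?mul0r.
rewrite mE; last 2 first.
  exact/measurable_EFinP.
  by move=> t; rewrite lee_fin; exact: fB0.
rewrite -ge0_integralZr//; last 3 first.
  by apply/measurable_EFinP; exact: mprod.
  by move=> t _; rewrite lee_fin prodr_ge0.
  by apply: integral_ge0 => t _; rewrite lee_fin; exact: fB0.
pose q (t : k.-tuple R * k.-tuple R) :=
  (\prod_(j < k) c j (tnth t.1 j) * fB t.2)%:E.
transitivity (\int[(m \x m)%E]_t q t)%E.
  rewrite fubini_tonelli1//; last 2 first.
    apply/measurable_EFinP; apply: measurable_funM.
      exact: (measurableT_comp (mprod c mc)).
    exact: measurableT_comp.
    by move=> t; rewrite lee_fin mulr_ge0// prodr_ge0.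
  apply: eq_integral => t _; rewrite /fubini_F /q/=.
  under [RHS]eq_integral do rewrite EFinM.
  rewrite ge0_integralZl_EFin//; last 2 first.
  - exact/measurable_EFinP.
  - by rewrite prodr_ge0.
  by move=> s _; rewrite lee_fin; exact: fB0.
rewrite [RHS]integral_mkcond; apply: eq_integral => -[t s] _.
rewrite patchE /q /p /fB /=; case: ifPn => [/set_mem [/= At Bs]|].
  rewrite indicE mem_set// mul1r; congr (_ * _)%:E.
  by apply: eq_bigr => j _; rewrite /c indicE mem_set ?mul1r.
(* Off the box, either the indicator of [B] vanishes or some coordinate of [t] leaves its [A j] and
   kills the product. *)
move=> nC; rewrite indicE; case: (boolP (s \in B)) => [sB|]; last first.
  by rewrite mul0r mulr0.
suff -> : \prod_(j < k) c j (tnth t j) = 0 by rewrite mul0r.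
have [j nAj] : exists j, ~ A j (tnth t j).
  apply/existsNP => At; move/negP: nC; apply.
  by apply/mem_set; split => //; exact/set_mem.
by rewrite (bigD1 j)//= /c indicE memNset// !mul0r.
Qed.

(** Both functions of [u] have the same integral over every measurable set, and [g] is integrable,
    so they agree almost everywhere. The vanishing of [b j] on nonpositive reals confines the
    argument to positive denominators, where the scaling rule applies. *)
Lemma quotient_density d (T : measurableType d) (R : realType)
    (P : probability T R) (k : nat) (b : 'I_k -> R -> R) (x v : T -> k.-tuple R)
    (f g : k.-tuple R -> R) :
  (forall j, measurable_fun setT (b j)) -> (forall j y, 0 <= b j y) ->
  (forall j y, y <= 0 -> b j y = 0) ->
  measurable_fun setT x -> measurable_fun setT v ->
  (forall j A, measurable A -> P ((fun w => tnth (x w) j) @^-1` A) =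
     (\int[@lebesgue_measure R]_(t in A) (b j t)%:E)%E) ->
  is_density_k P v f -> indep_coords_vec P x v ->
  is_density_k P (fun w => [tuple tnth (v w) j / tnth (x w) j | j < k]) g ->
  ae_k (fun u => (g u)%:E = iint (fun s =>
    (\prod_(j < k) (b j (tnth s j) * tnth s j) *
     f (mul_tuple R k (tnth s) u))%:E)).
Proof.
move=> mb b0 bN mx mv hb hf ind [g0 [mg hg]].
have [f0 [mf _]] := hf.
have [m mE] := iint_measure R k.
have mtnth d' (U : measurableType d') (h : U -> k.-tuple R) j :
    measurable_fun setT h -> measurable_fun setT (fun p => tnth (h p) j).
  by move=> mh; exact: (measurableT_comp (measurable_tnth j) mh).
pose div (p : k.-tuple R * k.-tuple R) :=
  [tuple tnth p.2 j / tnth p.1 j | j < k].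
have mdiv : measurable_fun setT div.
  apply/measurable_fun_tnthP => j.
  rewrite (_ : _ \o _ = fun p => tnth p.2 j / tnth p.1 j); last first.
    by apply/funext => p /=; rewrite tnth_mktuple.
  apply: measurable_funM; first exact: mtnth.
  by apply: (measurableT_comp (measurable_inv R)); exact: mtnth.
pose mult (p : k.-tuple R * k.-tuple R) := mul_tuple R k (tnth p.1) p.2.
have mmult : measurable_fun setT mult.
  apply/measurable_fun_tnthP => j.
  rewrite (_ : _ \o _ = fun p => tnth p.1 j * tnth p.2 j); last first.
    by apply/funext => p /=; rewrite tnth_mktuple.
  by apply: measurable_funM; exact: mtnth.
have mprodb : measurable_fun setT
    (fun s : k.-tuple R => \prod_(j < k) b j (tnth s j)).
  apply: measurable_prod => j _.
  by apply: (measurableT_comp (mb j)); exact: mtnth.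
pose h (p : k.-tuple R * k.-tuple R) :=
  \prod_(j < k) (b j (tnth p.1 j) * tnth p.1 j) * f (mult p).
have h0 p : 0 <= h p.
  rewrite mulr_ge0// prodr_ge0// => j _.
  have [le0|/ltW ge0] := leP (tnth p.1 j) 0; first by rewrite bN// mul0r.
  by rewrite mulr_ge0.
have mh : measurable_fun setT h.
  apply: measurable_funM; last exact: measurableT_comp.
  apply: measurable_prod => j _; apply: measurable_funM; last exact: mtnth.
  by apply: (measurableT_comp (mb j)); exact: mtnth.
pose G u := (\int[m]_s (h (s, u))%:E)%E.
have mG : measurable_fun setT G.
  apply: (measurable_fun_fubini_tonelli_G (m1 := m) (EFin \o h)).
    exact/measurable_EFinP.
  by move=> p; rewrite lee_fin.
have gG E : measurable E ->
    (\int[m]_(u in E) (g u)%:E = \int[m]_(u in E) G u)%E.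
  move=> mE'; rewrite -(ge0_iint_indic R k m g E mE)// -hg//.
  have mdE : measurable (div @^-1` E).
    by rewrite -[X in measurable X]setTI; exact: mdiv.
  rewrite -[X in P X]/((fun w => (x w, v w)) @^-1` (div @^-1` E)).
  rewrite (joint_law _ _ R P k m b x v f mE)// integral_mkcond.
  have mp : measurable_fun setT (fun p : k.-tuple R * k.-tuple R =>
      \1_(div @^-1` E) p * (\prod_(j < k) b j (tnth p.1 j) * f p.2)).
    apply: measurable_funM; first exact: measurable_indic.
    apply: measurable_funM; last exact: measurableT_comp.
    exact: (measurableT_comp mprodb).
  transitivity (\int[(m \x m)%E]_p
      (\1_(div @^-1` E) p * (\prod_(j < k) b j (tnth p.1 j) * f p.2))%:E)%E.
    apply: eq_integral => p _; rewrite patchE indicE.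
    by case: ifP; rewrite ?mul1r ?mul0r.
  rewrite fubini_tonelli1//; last 2 first.
    exact/measurable_EFinP.
    by move=> p; rewrite lee_fin !mulr_ge0// prodr_ge0.
  transitivity (\int[m]_s \int[m]_u (\1_E u * h (s, u))%:E)%E.
    apply: eq_integral => s _; rewrite /fubini_F/=.
    (* If some coordinate of [s] is nonpositive, both inner integrals are zero. Otherwise the second
       variable is scaled by [s]. *)
    have [/forallP s0|/forallPn[j]] := boolP [forall j, 0 < tnth s j];
      last first.
      rewrite -leNgt => sj.
      rewrite !integral0_eq// => u _.
        by rewrite /h/= (bigD1 j)//= bN// !mul0r mulr0.
      by rewrite (bigD1 j)//= bN// !mul0r mulr0.
    rewrite -!mE; last 4 first.
    - apply/measurable_EFinP; apply: measurable_funM.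
        exact: measurable_indic.
      exact: (measurableT_comp mh (pair1_measurable s)).
    - by move=> u; rewrite lee_fin mulr_ge0.
    - apply/measurable_EFinP; exact: (measurableT_comp mp (pair1_measurable s)).
    - by move=> u; rewrite lee_fin !mulr_ge0// prodr_ge0.
    rewrite (ge0_iint_scale R k (tnth s))//; last 2 first.
    - apply/measurable_EFinP; exact: (measurableT_comp mp (pair1_measurable s)).
    - by move=> u; rewrite lee_fin !mulr_ge0// prodr_ge0.
    rewrite -ge0_iintZl; last 3 first.
    - by apply: prodr_ge0 => j _; exact/ltW/s0.
    - apply/measurable_EFinP.
      apply: (measurableT_comp (measurableT_comp mp (pair1_measurable s))).
      exact: measurable_mul_tuple.
    - by move=> u; rewrite lee_fin !mulr_ge0// prodr_ge0.
    apply: eq_iint => u; rewrite -EFinM; congr EFin.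
    (* After scaling, the event that the quotient lies in [E] no longer involves [s], and the
       Jacobian supplies the factors [tnth s j] present in [h]. *)
    have divK : div (s, mult (s, u)) = u.
      apply: eq_from_tnth => j; rewrite !tnth_mktuple/= mulrAC divff ?mul1r//.
      by rewrite gt_eqF// s0.
    have -> : \1_(div @^-1` E) (s, mul_tuple R k (tnth s) u) = \1_E u :> R.
      by rewrite !indicE -[in RHS]divK.
    by rewrite /h/= big_split/=; ring.
  (* Exchanging the integrals puts [u] outside, where the indicator of [E] restricts the domain and
     the inner integral is [G u]. *)
  rewrite (fubini_tonelli (fun p => (\1_E p.2 * h p)%:E))//; last 2 first.
    apply/measurable_EFinP; apply: measurable_funM => //.
    have mE1 : measurable_fun setT (\1_E : k.-tuple R -> R).
      exact: measurable_indic.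
    exact: (measurableT_comp mE1 measurable_snd).
    by move=> p; rewrite lee_fin mulr_ge0.
  rewrite [RHS]integral_mkcond; apply: eq_integral => u _ /=.
  rewrite patchE indicE; case: ifP => _.
    by apply: eq_integral => s _; rewrite mul1r.
  by apply: integral0_eq => s _; rewrite mul0r.
(* The integral of [g] is the total probability, hence finite. *)
have ig : m.-integrable setT (EFin \o g).
  apply/integrableP; split; first exact/measurable_EFinP.
  rewrite (eq_integral (EFin \o g)); last first.
    by move=> u _ /=; rewrite ger0_norm.
  by rewrite -(ge0_iint_indic R k m g setT mE)// -hg// preimage_setT
    probability_setT ltry.
have [|N [mN N0 sub]] :=
  @integral_ae_eq _ _ _ m setT measurableT G (EFin \o g) ig mG.
  by move=> E _ mE0; exact: gG.
exists N; split => //; split.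
  rewrite mE; last 2 first.
  - by apply/measurable_EFinP; exact: measurable_indic.
  - by move=> t; rewrite lee_fin.
  by rewrite integral_indic// setIT.
move=> u /= nu; apply: sub => /= /(_ I) gu; apply: nu.
rewrite gu /G mE//.
- apply/measurable_EFinP; exact: (measurableT_comp mh (pair2_measurable u)).
- by move=> s; rewrite lee_fin; exact: (h0 (s, u)).
Qed.

(** * The type-1 beta density *)

Lemma Gamma_ge0 (R : realType) (s : R) : 0 <= Gamma s.
Proof.
apply: fine_ge0; apply: integral_ge0 => t _.
by rewrite lee_fin mulr_ge0 ?powR_ge0 ?expR_ge0.
Qed.

Lemma beta1_pdf_ge0 (R : realType) (z a t : R) : 0 <= beta1_pdf z a t.
Proof.
by rewrite /beta1_pdf !mulr_ge0 ?invr_ge0 ?powR_ge0 ?mulr_ge0 ?Gamma_ge0.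
Qed.

Lemma measurable_beta1_pdf (R : realType) (z a : R) :
  measurable_fun setT (beta1_pdf z a).
Proof.
apply: measurable_funM; first exact: measurable_indic.
apply: measurable_funM.
  by apply: measurable_funM => //; exact: measurable_powR.
apply: (measurableT_comp (measurable_powR (a - 1))).
exact: measurable_funB.
Qed.

Lemma beta1_pdf_out (R : realType) (z a t : R) :
  ~~ (0 < t < 1) -> beta1_pdf z a t = 0.
Proof.
by move=> /negbTE t01; rewrite /beta1_pdf indicE mem_setE in_itv/= t01 !mul0r.
Qed.

(* The normalising constant of a density of total mass 1 cannot vanish, so no
   property of the Gamma integral beyond its sign is required. *)
Lemma Gamma_neq0 (R : realType) (z a : R) :
  (\int[@lebesgue_measure R]_t (beta1_pdf z a t)%:E = 1)%E ->
  [/\ Gamma (z + a) != 0, Gamma z != 0 & Gamma a != 0].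
Proof.
move=> I1; suff : Gamma (z + a) / (Gamma z * Gamma a) != 0.
  move: (Gamma (z + a)) (Gamma z) (Gamma a) => A B D.
  by rewrite mulf_eq0 invr_eq0 mulf_eq0 !negb_or => /and3P[].
apply/eqP => c0; move: I1; rewrite integral0_eq.
  by move/eqP; rewrite eq_sym onee_eq0.
by move=> t _; rewrite /beta1_pdf c0 !mul0r mulr0.
Qed.

(** One coordinate of the substitution x = s/t. The extra factor [t^-1 * s] raises the exponent z -
    1 of the beta density to the Kober exponent z. The constants are grouped as inverse Kober
    prefactor, Gamma ratio and Jacobian, ready for [prod_mulVK]. *)
Lemma beta1_pdf_ratio (R : realType) (z a s t : R) :
  0 < s < t -> Gamma (z + a) != 0 -> Gamma z != 0 -> Gamma a != 0 ->
  (t - s) `^ (a - 1) * s `^ z =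
  (t `^ (- z - a) / Gamma a)^-1 * (Gamma z / Gamma (z + a)) * t^-1 *
  (beta1_pdf z a (t^-1 * s) * (t^-1 * s)).
Proof.
move=> /andP[s0 st] Gza Gz Ga; have t0 : 0 < t by exact: lt_trans st.
have tn0 : t != 0 by rewrite gt_eqF.
pose q := t^-1 * s; have q0 : 0 < q by rewrite mulr_gt0 ?invr_gt0.
have q1 : q < 1 by rewrite /q mulrC ltr_pdivrMr ?mul1r.
have sE : s = t * q by rewrite /q mulrA divff ?mul1r.
have qz : q `^ z = q `^ (z - 1) * q.
  rewrite -[X in _ * X](powRr1 (ltW q0)) -powRD ?subrK//.
  by rewrite (gt_eqF q0) implybT.
have e1 : (t - s) `^ (a - 1) = t `^ (a - 1) * (1 - q) `^ (a - 1).
  by rewrite -powRM ?subr_ge0 ?(ltW t0) ?(ltW q1)// mulrBr mulr1 -sE.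
have e2 : s `^ z = t `^ z * (q `^ (z - 1) * q).
  by rewrite sE powRM ?(ltW t0) ?(ltW q0)// qz.
rewrite -/q e1 e2.
rewrite /beta1_pdf indicE mem_set/= ?in_itv/= ?q0 ?q1// mul1r.
(* Writing s = t q leaves the power a - 1 + z of t, which is the inverse Kober power times the
   Jacobian 1/t. *)
have tz : t `^ (a - 1) * t `^ z = (t `^ (- z - a))^-1 * t^-1.
  rewrite -powRN -[X in _ = _ * X](powR_inv1 (ltW t0)) -!powRD; last 2 first.
  - by rewrite tn0 implybT.
  - by rewrite tn0 implybT.
  by congr (_ `^ _); ring.
have pz : t `^ (- z - a) != 0 by rewrite gt_eqF// powR_gt0.
transitivity (
    (t `^ (a - 1) * t `^ z) * ((1 - q) `^ (a - 1) * (q `^ (z - 1) * q))).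
  by ring.
rewrite tz.
move: (Gamma (z + a)) (Gamma z) (Gamma a) Gza Gz Ga => A B D A0 B0 D0; field.
by rewrite tn0 pz A0 B0 D0.
Qed.

(** * Identification with the Kober integral *)

Lemma prod_mulVK (R : realType) (k : nat) (K Q r : 'I_k -> R) :
  (forall j, K j != 0) ->
  (\prod_(j < k) K j) * \prod_(j < k) ((K j)^-1 * Q j * r j) =
  (\prod_(j < k) Q j) * \prod_(j < k) r j.
Proof.
move=> K0; rewrite -!big_split/=; apply: eq_bigr => j _.
by rewrite !mulrA divff ?mul1r.
Qed.

Theorem theorem2p1 (R : realType) (k : nat) (hk : (1 <= k)%N)
    (z a : 'I_k -> R) (hz : forall j, 0 < z j) (ha : forall j, 0 < a j)
    (d : measure_display) (T : measurableType d) (P : probability T R)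
    (x v : T -> k.-tuple R)
    (hxm : measurable_fun setT x) (hvm : measurable_fun setT v)
    (hx : forall j : 'I_k, forall A : set R, measurable A ->
       P ((fun w => tnth (x w) j) @^-1` A) =
       (\int[@lebesgue_measure R]_(t in A) (beta1_pdf (z j) (a j) t)%:E)%E)
    (f : k.-tuple R -> R)
    (hvpos : forall w j, 0 < tnth (v w) j)
    (hf : is_density_k P v f)
    (hind : indep_coords_vec P x v)
    (g : k.-tuple R -> R)
    (hg : is_density_k P
            (fun w => [tuple tnth (v w) j / tnth (x w) j | j < k]) g) :
  ae_k (fun t : k.-tuple R => (forall j, 0 < tnth t j) ->
     ((\prod_(j < k) (Gamma (z j) / Gamma (z j + a j))) * g t)%:E =
     kober z a f t).
Proof.
(* Taking [A = setT] in [hx] shows that each beta density has total mass 1. *)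
have GN j : [/\ Gamma (z j + a j) != 0, Gamma (z j) != 0 & Gamma (a j) != 0].
  by apply: Gamma_neq0; rewrite -hx// preimage_setT probability_setT.
pose b j := beta1_pdf (z j) (a j).
have mb j : measurable_fun setT (b j) by exact: measurable_beta1_pdf.
have b0 j y : 0 <= b j y by exact: beta1_pdf_ge0.
have bN j y : y <= 0 -> b j y = 0.
  by move=> y0; apply: beta1_pdf_out; rewrite ltNge y0.
have [f0 [mf _]] := hf.
have [N [mN [N0 sub]]] := quotient_density _ _ R P k b x v f g mb b0 bN hxm hvm
  hx hf hind hg.
(* The exceptional null set is that of [quotient_density]; from here on [t] is a fixed point with
   positive coordinates. *)
exists N; split => //; split => // t nt; apply: sub => /= gt; apply: nt => t0.
pose F (s : k.-tuple R) := \prod_(j < k) (b j (tnth s j) * tnth s j) *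
  f (mul_tuple R k (tnth s) t).
pose ti j := (tnth t j)^-1.
have ti0 j : 0 < ti j by rewrite invr_gt0.
have F0 s : 0 <= F s.
  rewrite mulr_ge0// prodr_ge0// => j _.
  have [le0|/ltW ge0] := leP (tnth s j) 0; first by rewrite bN// mul0r.
  by rewrite mulr_ge0.
have mF : measurable_fun setT (EFin \o F).
  apply/measurable_EFinP; apply: measurable_funM.
    apply: measurable_prod => j _; apply: measurable_funM.
      exact: (measurableT_comp (mb j) (measurable_tnth j)).
    exact: measurable_tnth.
  apply: (measurableT_comp mf); apply/measurable_fun_tnthP => j.
  rewrite (_ : _ \o _ = fun s => tnth s j * tnth t j).
    by apply: measurable_funM => //; exact: measurable_tnth.
  by apply/funext => s /=; rewrite tnth_mktuple.
(* With [t] fixed, x = v/t is a scaling of the integration variable with ratios [ti j]. *)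
have gtE : (g t)%:E = ((\prod_(j < k) ti j)%:E *
    iint (fun s => (F (mul_tuple R k ti s))%:E))%E.
  by rewrite gt; exact: (ge0_iint_scale R k ti (EFin \o F)).
pose K j := tnth t j `^ (- z j - a j) / Gamma (a j).
pose Q j := Gamma (z j) / Gamma (z j + a j).
have K0 j : 0 < K j.
  by have [_ _ Ga] := GN j; rewrite divr_gt0 ?powR_gt0// lt_def Ga Gamma_ge0.
have Q0 j : 0 <= Q j by rewrite divr_ge0 ?Gamma_ge0.
pose C := \prod_(j < k) ((K j)^-1 * Q j * ti j).
(* The Kober integrand is pointwise the constant [C] times the rescaled integrand of [g]; the
   prefactor [K] then cancels, leaving the Gamma ratios and the Jacobian. *)
rewrite /kober (eq_iint R k _ (fun s => C%:E * (F (mul_tuple R k ti s))%:E)%E).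
  rewrite ge0_iintZl; last 3 first.
  - apply: prodr_ge0 => j _; apply: mulr_ge0; last exact/ltW/ti0.
    by apply: mulr_ge0; [rewrite invr_ge0; exact/ltW/K0|exact: Q0].
  - exact: (measurableT_comp mF (measurable_mul_tuple R k ti)).
  - by move=> s; rewrite lee_fin.
  rewrite EFinM gtE muleA [RHS]muleA -!EFinM; congr (_%:E * _)%E.
  by symmetry; apply: (prod_mulVK R k K Q ti) => j; rewrite gt_eqF ?K0.
move=> s; rewrite -EFinM; congr EFin.
rewrite indicE; have [/set_mem/= st|] := boolP (s \in _).
  rewrite mul1r /F mulrA; congr (_ * _).
    rewrite /C -big_split/=; apply: eq_bigr => j _; have [? ? ?] := GN j.
    by rewrite tnth_mktuple; exact: beta1_pdf_ratio.
  congr f; apply: eq_from_tnth => j; rewrite !tnth_mktuple.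
  by rewrite mulrAC mulVf ?mul1r// gt_eqF.
move=> /negP st; rewrite !mul0r.
(* Outside the Kober domain of integration some ratio of [s] to [t] lies outside ]0, 1[, where the
   beta density vanishes just as the indicator does. *)
have [j sj] : exists j, ~ (0 < tnth s j < tnth t j).
  by apply/existsNP => h; apply: st; exact/mem_set.
rewrite /F (bigD1 j)//= tnth_mktuple [b j _]beta1_pdf_out ?mul0r ?mulr0//.
apply/negP => /andP[s0 s1]; apply: sj; move: s0 s1.
by rewrite pmulr_rgt0// => ->; rewrite /ti mulrC ltr_pdivrMr ?mul1r.
Qed.
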